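(* Let $X=\{\{X_{k,n},\ 1\le k\le k(n)\},\ n\ge1\}$ be an array of random variables defined on the same probability space, with $k(n)\to+\infty$, such that for each $n$ the row $\{X_{k,n},1\le k\le k(n)\}$ is associated. Let $(m(n),\ell(n),r(n))_{n\ge1}$ be sequences of non-negative integers with $k(n)=m(n)\ell(n)+r(n)$, $1\le m(n)\to+\infty$, $0\le r(n)<\ell(n)$ and $\ell(n)/m(n)\to0$. Suppose that: (1) for all $1\le k\le k(n)$, $X_{k,n}$ has the same law as $Z_{k,n}-1$, where $Z_{k,n}$ has the geometric law $\mathcal G(p_{k,n})$ with $0<p_{k,n}<1$; (2) with $q_{k,n}=1-p_{k,n}$, as $n\to+\infty$: (a) $\overline q_n:=\sup_{1\le k\le k(n)}q_{k,n}\to0$; (b) $k(n)\,\overline q_n^2\to0$; (3) as $n\to+\infty$: (a) $\sum_{k=1}^{k(n)}q_{k,n}\to\lambda>0$; (b) $\sum_{h=1}^{r(n)}q_{m(n)\ell(n)+h,n}\to0$; (c) $k(n)^2\sup_{1\le r\ne s\le k(n)}\mathrm{Cov}(X_{r,n},X_{s,n})\to0$; (4) as $n\to+\infty$: (a) $m(n)\sup_{1\le j\le m(n)}\sum_{1\le r\ne s\le\ell(n)}\mathrm{Cov}\left(X_{(j-1)\ell(n)+r,n},X_{(j-1)\ell(n)+s,n}\right)\to0$; (b) $\sum_{1\le r\ne s\le r(n)}\mathrm{Cov}\left(X_{m(n)\ell(n)+r,n},X_{m(n)\ell(n)+s,n}\right)\to0$. Then $S_n[X]=\sum_{k=1}^{k(n)}X_{k,n}$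 converges weakly to the Poisson law $\mathcal P(\lambda)$.
   Context: Random variables $Z_1,\dots,Z_n$ are associated if for any coordinate-wise non-decreasing functions $h,g:\mathbb R^n\to\mathbb R$ one has $\mathrm{Cov}(h(Z_1,\dots,Z_n),g(Z_1,\dots,Z_n))\ge0$ (whenever the covariance exists). The geometric law $\mathcal G(p)$ is $\mathbb P(Z=k)=p(1-p)^{k-1}$, $k\ge1$. *)

(* Defs.v *)
From HB Require Import structures.
From mathcomp Require Export all_boot all_order all_algebra.
From mathcomp Require Export all_classical all_reals all_analysis measurable_realfun.
Export numFieldNormedType.Exports.

Set Implicit Arguments.
Unset Strict Implicit.
Unset Printing Implicit Defensive.

Import Order.TTheory GRing.Theory Num.Theory.

#[global] Open Scope classical_set_scope.
#[global] Open Scope ring_scope.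

Definition coord_nondecreasing (R : realType) (n : nat) (h : 'rV[R]_n -> R) :=
  forall x y : 'rV[R]_n, (forall i, x 0 i <= y 0 i) -> h x <= h y.

(* A coordinate-wise non-decreasing function need not be Borel. Membership in
   [Lfun P 1] (measurability and integrability) of h(Z), g(Z) and h(Z)g(Z) is
   what it means for the covariance to exist. *)
Definition associated d (T : measurableType d) (R : realType)
    (P : probability T R) (n : nat) (Z : 'I_n -> {RV P >-> R}) :=
  forall h g : 'rV[R]_n -> R,
    coord_nondecreasing h -> coord_nondecreasing g ->
    let hZ : T -> R := fun w => h (\row_i Z i w) in
    let gZ : T -> R := fun w => g (\row_i Z i w) in
    hZ \in Lfun P 1 -> gZ \in Lfun P 1 -> (hZ \* gZ) \in Lfun P 1 ->
    (0 <= covariance P hZ gZ)%E.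

(* A measure takes unspecified values outside the sigma-algebra, so laws are
   only compared on measurable sets. *)
Definition same_law d1 d2 (T1 : measurableType d1) (T2 : measurableType d2)
    (R : realType) (P : probability T1 R) (Q : probability T2 R)
    (X : {RV P >-> R}) (Y : {RV Q >-> R}) :=
  forall A : set R, measurable A -> distribution P X A = distribution Q Y A.

Definition weakly_converges (R : realType)
    (mu : nat -> probability R R) (nu : probability R R) :=
  forall f : R -> R, continuous f -> bounded_fun f ->
    (\int[mu n]_x f x)%R @[n --> \oo] --> (\int[nu]_x f x)%R.

Definition geometric_pmf (R : realType) (p : R) (k : nat) : R :=
  if (1 <= k)%N then p * (1 - p) ^+ (k - 1) else 0.

Lemma geometric_pmf_ge0 (R : realType) (p : R) k :
  0 < p <= 1 -> 0 <= geometric_pmf p k.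
Proof.
move=> /andP[p0 p1]; rewrite /geometric_pmf; case: ifP => // _.
by rewrite mulr_ge0 ?exprn_ge0 ?subr_ge0// ltW.
Qed.

(* Outside 0 < p <= 1 the value is a Dirac mass, so that [geometric_prob p] is
   a probability measure for all p. *)
Definition geometric_prob (R : realType) (p : R) : set nat -> \bar R :=
  fun U => if 0 < p <= 1 then
    (\esum_(k in U) (geometric_pmf p k)%:E)%E else \d_1%N U.

Section geometric.
Context {R : realType} (p : R).
Local Open Scope ereal_scope.

Let geometric0 : geometric_prob p set0 = 0.
Proof. by rewrite /geometric_prob measure0; case: ifPn => //; rewrite esum_set0. Qed.

Let geometric_ge0 U : 0 <= geometric_prob p U.
Proof.
rewrite /geometric_prob; case: ifPn => // p01; apply: esum_ge0 => /= n Un.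
by rewrite lee_fin geometric_pmf_ge0.
Qed.

Let geometric_sigma_additive : semi_sigma_additive (geometric_prob p).
Proof.
move=> F mF tF mUF; rewrite /geometric_prob; case: ifPn => p01; last first.
  exact: measure_semi_sigma_additive.
apply: cvg_toP.
  apply: ereal_nondecreasing_is_cvgn => a b ab.
  apply: lee_sum_nneg_natr => // n _ _.
  by apply: esum_ge0 => /= ? _; rewrite lee_fin geometric_pmf_ge0.
by rewrite nneseries_sum_bigcup// => i; rewrite lee_fin geometric_pmf_ge0.
Qed.

HB.instance Definition _ := isMeasure.Build _ _ _ (geometric_prob p)
  geometric0 geometric_ge0 geometric_sigma_additive.

Let geometric_setT : geometric_prob p [set: nat] = 1.
Proof.
rewrite /geometric_prob; case: ifPn => [p01|_]; last by rewrite probability_setT.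
rewrite -nneseries_esumT; last by move=> *; rewrite lee_fin geometric_pmf_ge0.
have /andP[p0 p1] := p01.
apply/cvg_lim => //; rewrite -cvg_shiftS/=.
have -> : (fun n => \sum_(0 <= k < n.+1) (geometric_pmf p k)%:E) =
    EFin \o series (geometric p (1 - p)%R).
  apply/funext => n; rewrite big_nat_recl//= add0e sumEFin; congr EFin.
  by apply: eq_bigr => i _; rewrite /geometric_pmf/= subn1.
apply: cvg_EFin; first exact: nearW.
have := @cvg_geometric_series R p (1 - p)%R.
rewrite (_ : (1 - (1 - p) = p)%R) ?divff ?gt_eqF//; last first.
  by rewrite opprB addrCA subrr addr0.
by apply; rewrite ger0_norm ?subr_ge0// ltrBlDr ltrDl.
Qed.

HB.instance Definition _ :=
  @Measure_isProbability.Build _ _ R (geometric_prob p) geometric_setT.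

End geometric.

Section natr_rv.
Context (R : realType).

(* The inclusion of the discrete space nat into R: the canonical random variable
   whose law is a given probability on nat, seen as a law on R. *)
Definition natr_rv (k : nat) : R := k%:R.

Let measurable_natr_rv : measurable_fun [set: nat] natr_rv.
Proof. by []. Qed.

HB.instance Definition _ := isMeasurableFun.Build _ _ _ _ natr_rv
  measurable_natr_rv.

End natr_rv.

(* [poisson_prob] has a second argument, on which it does not depend. *)
Definition poisson_law (R : realType) (lambda : R) : probability R R :=
  distribution (poisson_prob lambda 0) (natr_rv R).

(* Main.v *)
Require Import Defs.
From mathcomp Require Import ring lra.
Import Order.TTheory GRing.Theory Num.Theory.

(** The variables of a row and the Poisson law live on the natural numbers, so
    Laplace transforms decide weak convergence: if E exp (- t S_n) converges for
    every t > 0, then so do the generating functions, hence the point masses one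
    after the other ([cvg_mass]), hence the laws, as the limiting masses add up to
    1 ([cvg_mass_weakly]).

    If the variables of a row were independent, E exp (- t S_n) would be the
    product of the transforms p / (1 - q s) of the shifted geometric laws, where
    s = exp (- t). Each factor lies between exp (- (1 - s) q / (1 - qbar)) and
    exp (- (1 - s) q); as the largest q tends to 0 and the sum of the q to lambda,
    the product tends to exp (- (1 - s) lambda), the transform of the Poisson law
    ([cvg_prod_geometric_laplace], [poisson_laplace]).

    Association replaces independence. The function exp (- t x) is non-increasing
    and t-Lipschitz on the half-line, and for associated variables such functions
    satisfy Newman's inequality ([expectation_prod_le]): the expectation of the
    product differs from the product of the expectations by at most t^2 times the
    sum of the covariances of distinct variables. Each of the fewer than k(n)^2
    terms of this sum is at most the supremum of the covariances, and k(n)^2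
    times that supremum tends to 0. *)

Set Implicit Arguments.
Unset Strict Implicit.
Unset Printing Implicit Defensive.

(** * Square integrable variables *)

Section square_integrable.
Context d (T : measurableType d) (R : realType) (P : probability T R).

Lemma Lfun2_sqr (f : T -> R) : measurable_fun [set: T] f ->
  (\int[P]_x ((f x) ^+ 2)%:E < +oo)%E -> f \in Lfun P 2%:E.
Proof.
move=> mf ioo; rewrite inE/=; apply/andP; split; rewrite inE//=.
rewrite /finite_norm unlock /Lnorm poweR_lty//.
rewrite (eq_integral (fun x => ((f x) ^+ 2)%:E)) => [//|x _].
by rewrite /= powR_mulrn// -normrX ger0_norm ?sqr_ge0//.
Qed.

Lemma Lfun2_bounded (f : T -> R) M : measurable_fun [set: T] f ->
  (forall x, `|f x| <= M) -> f \in Lfun P 2%:E.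
Proof.
move=> mf fM; apply: Lfun2_sqr => //.
apply: (@le_lt_trans _ _ (\int[P]_x (M ^+ 2)%:E)%E).
  apply: ge0_le_integral => //.
  - by move=> x _; rewrite lee_fin sqr_ge0.
  - by apply/measurable_EFinP; exact: measurable_funX.
  - move=> x _; rewrite lee_fin -(real_normK (num_real (f x))).
    by rewrite lerXn2r// ?nnegrE// (le_trans _ (fM x)).
by rewrite integral_cst//= probability_setT mule1 ltry.
Qed.

Lemma Lfun21 (f : T -> R) : f \in Lfun P 2%:E -> f \in Lfun P 1.
Proof. by apply: Lfun_subset12; exact: fin_num_measure. Qed.

Lemma Lfun2D (f g : T -> R) : f \in Lfun P 2%:E -> g \in Lfun P 2%:E ->
  f \+ g \in Lfun P 2%:E.
Proof. by move=> f2 g2; apply: (rpredD f2 g2); exact: lee1n. Qed.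

Lemma Lfun2N (f : T -> R) : f \in Lfun P 2%:E -> \- f \in Lfun P 2%:E.
Proof. by move=> f2; rewrite (@rpredN _ (Lfun P 2%:E)) ?lee1n. Qed.

Lemma Lfun2_sum (I : Type) (s : seq I) (f : I -> T -> R) :
  (forall i, f i \in Lfun P 2%:E) ->
  (fun w => \sum_(i <- s) f i w) \in Lfun P 2%:E.
Proof.
move=> f2; elim: s => [|i s ih].
  by under eq_fun do rewrite big_nil; exact: Lfun_cst.
have -> : (fun w => \sum_(j <- i :: s) f j w) =
    f i \+ (fun w => \sum_(j <- s) f j w).
  by apply/funext => w; rewrite big_cons.
exact: Lfun2D.
Qed.

Lemma fin_num_covariance (f g : T -> R) :
  f \in Lfun P 2%:E -> g \in Lfun P 2%:E -> covariance P f g \is a fin_num.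
Proof.
move=> f2 g2.
by apply: covariance_fin_num; [exact: Lfun21..|exact: Lfun2_mul_Lfun1].
Qed.

Lemma covariance_suml (I : Type) (s : seq I) (f : I -> T -> R) (g : T -> R) :
  (forall i, f i \in Lfun P 2%:E) -> g \in Lfun P 2%:E ->
  covariance P (fun w => \sum_(i <- s) f i w) g =
  (\sum_(i <- s) covariance P (f i) g)%E.
Proof.
move=> f2 g2; elim: s => [|i s ih].
  by under eq_fun do rewrite big_nil; rewrite big_nil; exact: covariance_cst_l.
rewrite big_cons -ih -covarianceDl//; last exact: Lfun2_sum.
by congr covariance; apply/funext => w; rewrite big_cons.
Qed.

End square_integrable.

(** * Covariance bounds for associated variables *)

Section newman.
Context (R : realType) (phi : R -> R) (c : R).
Hypothesis c_ge0 : 0 <= c.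
Hypothesis phi_ge0 : forall x, 0 <= phi x.
Hypothesis phi_le1 : forall x, phi x <= 1.
Hypothesis phi_noninc : forall x y, x <= y -> phi y <= phi x.
Hypothesis phi_lip : forall x y, x <= y -> phi x - phi y <= c * (y - x).

Lemma prod_in01 (I : Type) (s : seq I) (x : I -> R) :
  0 <= \prod_(i <- s) phi (x i) <= 1.
Proof. by rewrite prodr_ge0//= prodr_ile1// => i _; rewrite phi_ge0 phi_le1. Qed.

(** Telescoping the product: every factor that is not being compared lies in
    [0, 1], so the differences of the factors just add up. *)
Lemma prod_lip (I : Type) (s : seq I) (x y : I -> R) :
  (forall i, x i <= y i) ->
  \prod_(i <- s) phi (x i) - \prod_(i <- s) phi (y i) <=
  c * (\sum_(i <- s) y i - \sum_(i <- s) x i).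
Proof.
move=> xy; elim: s => [|i s ih]; first by rewrite !big_nil !subrr mulr0.
rewrite !big_cons.
have /andP[a0 a1] := prod_in01 s x; have /andP[b0 b1] := prod_in01 s y.
have := phi_lip (xy i); have := phi_noninc (xy i).
have := phi_ge0 (y i); have := phi_le1 (y i).
have : \prod_(j <- s) phi (y j) <= \prod_(j <- s) phi (x j).
  by apply: ler_prod => j _; rewrite phi_ge0/= phi_noninc.
nra.
Qed.

Context d (T : measurableType d) (P : probability T R) (n : nat)
  (Z : 'I_n -> {RV P >-> R}).
Hypothesis Z_assoc : associated Z.
Hypothesis Z2 : forall i, (Z i : T -> R) \in Lfun P 2%:E.

(** For square integrable functions of the row the covariance always exists, so
    association applies without integrability side conditions. *)
Lemma associated_covariance_ge0 (h g : ('I_n -> R) -> R) :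
  (forall x y, (forall i, x i <= y i) -> h x <= h y) ->
  (forall x y, (forall i, x i <= y i) -> g x <= g y) ->
  (fun w => h (Z ^~ w)) \in Lfun P 2%:E ->
  (fun w => g (Z ^~ w)) \in Lfun P 2%:E ->
  (0 <= covariance P (fun w => h (Z ^~ w)) (fun w => g (Z ^~ w)))%E.
Proof.
move=> hh gg h2 g2.
have rowE (f : ('I_n -> R) -> R) :
    (fun w => f ((\row_i Z i w) 0)) = (fun w => f (Z ^~ w)).
  by apply/funext => w; congr f; apply/funext => i; rewrite mxE.
have := Z_assoc (h := fun x => h (x 0)) (g := fun x => g (x 0)).
rewrite /= !rowE; apply.
- by move=> x y xy; exact: hh.
- by move=> x y xy; exact: gg.
- exact: Lfun21.
- exact: Lfun21.
- exact: Lfun2_mul_Lfun1.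
Qed.

Let measurable_phi : measurable_fun [set: R] phi.
Proof. by apply: nonincreasing_measurable => // x y; exact: phi_noninc. Qed.

Let W (s : seq 'I_n) w := \prod_(i <- s) phi (Z i w).

Let W2 s : W s \in Lfun P 2%:E.
Proof.
apply: (@Lfun2_bounded _ _ _ _ _ 1).
  by apply: measurable_prod => i _; exact: measurableT_comp.
by move=> w; have /andP[? ?] := prod_in01 s (Z ^~ w); rewrite ger0_norm.
Qed.

Let phi2 i : (fun w => phi (Z i w)) \in Lfun P 2%:E.
Proof.
by have := W2 [:: i]; rewrite /W; under eq_fun do rewrite big_seq1.
Qed.

Lemma covariance_ge0 i j : (0 <= covariance P (Z i) (Z j))%E.
Proof.
by apply: (@associated_covariance_ge0 (fun x => x i) (fun x => x j)).
Qed.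

(** Put A = sum_(j <- s) Z_j and V = phi (Z_i), and let W be the product of
    the phi (Z_j). Since phi is non-increasing and c-Lipschitz, c A + W and
    c Z_i + V are non-decreasing functions of the row, and so are c A, - W and
    - V. Association of - W and - V is the lower bound; applied to the pairs
    (c A + W, - V) and (c A, c Z_i + V), it gives
    Cov (W, V) <= - Cov (c A, V) <= Cov (c A, c Z_i). *)
Lemma covariance_prod s i :
  (0 <= covariance P (W s) (fun w => phi (Z i w)) <=
   (c ^+ 2)%:E * \sum_(j <- s) covariance P (Z j) (Z i))%E.
Proof.
pose A w := \sum_(j <- s) Z j w.
have A2 : A \in Lfun P 2%:E by exact: Lfun2_sum.
have sE : covariance P A (Z i) = (\sum_(j <- s) covariance P (Z j) (Z i))%E.
  exact: covariance_suml.
have cA2 : (c \o* A) \in Lfun P 2%:E by rewrite Lfun_scale// ler1n.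
have cZ2 : (c \o* Z i) \in Lfun P 2%:E by rewrite Lfun_scale// ler1n.
pose V w := phi (Z i w).
have V2 : V \in Lfun P 2%:E by exact: phi2.
have W_noninc (x y : 'I_n -> R) : (forall i, x i <= y i) ->
    \prod_(i <- s) phi (y i) <= \prod_(i <- s) phi (x i).
  by move=> xy; apply: ler_prod => j _; rewrite phi_ge0/= phi_noninc.
have NWV : covariance P (\- W s) (\- V) = covariance P (W s) V.
  by apply: covarianceNN; [exact: Lfun21..|exact: Lfun2_mul_Lfun1].
apply/andP; split.
  rewrite -/V -NWV.
  apply: (@associated_covariance_ge0 (fun x => - \prod_(j <- s) phi (x j))
    (fun x => - phi (x i))); rewrite ?Lfun2N//.
  - by move=> x y xy; rewrite lerN2 W_noninc.
  - by move=> x y xy; rewrite lerN2 phi_noninc.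
  - exact: W2.
have h1 : (0 <= covariance P (c \o* A \+ W s) (\- V))%E.
  apply: (@associated_covariance_ge0
    (fun x => (\sum_(j <- s) x j) * c + \prod_(j <- s) phi (x j))
    (fun x => - phi (x i))); rewrite ?Lfun2N//.
  - by move=> x y xy; have := prod_lip s xy; lra.
  - by move=> x y xy; rewrite lerN2 phi_noninc.
  - exact: (Lfun2D cA2 (W2 s)).
have h2 : (0 <= covariance P (c \o* A) (c \o* Z i \+ V))%E.
  apply: (@associated_covariance_ge0
    (fun x => (\sum_(j <- s) x j) * c) (fun x => x i * c + phi (x i))) => //.
  - by move=> x y xy; rewrite ler_wpM2r// ler_sum.
  - by move=> x y xy; have := phi_lip (xy i); lra.
  - exact: (Lfun2D cZ2 V2).
move: h1 h2.
rewrite (covarianceDl cA2 (W2 s) (Lfun2N V2)) (covarianceDr cA2 cZ2 V2).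
have L1 f g : f \in Lfun P 2%:E -> g \in Lfun P 2%:E ->
  [/\ f \in Lfun P 1, g \in Lfun P 1 & f * g \in Lfun P 1].
  by move=> f2 g2; split; [exact: Lfun21..|exact: Lfun2_mul_Lfun1].
have [A1 V1 AV1] := L1 _ _ A2 V2; have [cA1 _ cAV1] := L1 _ _ cA2 V2.
have [W1 _ WV1] := L1 _ _ (W2 s) V2; have [_ Z1 AZ1] := L1 _ _ A2 (Z2 i).
have [_ _ cAZ1] := L1 _ _ cA2 (Z2 i).
rewrite (covarianceNr W1 V1 WV1) (covarianceNr cA1 V1 cAV1).
rewrite covarianceZr// !covarianceZl//.
rewrite -sE -/V muleA -EFinM -expr2.
have := fin_num_covariance (W2 s) V2; have := fin_num_covariance A2 V2.
move: (fin_num_covariance A2 (Z2 i)) => /fineK <- /fineK <- /fineK <-.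
by rewrite -!EFinN -!EFinM -!EFinD !lee_fin; lra.
Qed.

(** Newman's inequality, for a real-valued phi in place of the complex
    exponential: if the covariances are small then expectation is nearly
    multiplicative on the phi (Z_i). One factor is split off at a time, and the
    error made in doing so is the covariance bounded in [covariance_prod]. *)
Lemma expectation_prod_le (s : seq 'I_n) : uniq s ->
  `|fine 'E_P[W s] - \prod_(i <- s) fine 'E_P[fun w => phi (Z i w)]| <=
  c ^+ 2 * \sum_(i <- s) \sum_(j <- s | i != j) fine (covariance P (Z i) (Z j)).
Proof.
elim: s => [_|i s ih /= /andP[iNs us]].
  rewrite /W; under [X in expectation _ X]eq_fun do rewrite big_nil.
  by rewrite (expectation_cst P 1)/= !big_nil subrr normr0 mulr0.
rewrite big_cons.
have Wcons : W (i :: s) = W s * (fun w => phi (Z i w)).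
  by apply/funext => w; rewrite /W big_cons mulrC.
have /andP[C0 C1] := covariance_prod s i.
have fC : covariance P (W s) (fun w => phi (Z i w)) \is a fin_num.
  exact: fin_num_covariance.
have EW : fine 'E_P[W s] * fine 'E_P[fun w => phi (Z i w)] +
    fine (covariance P (W s) (fun w => phi (Z i w))) = fine 'E_P[W (i :: s)].
  have L1 := Lfun2_mul_Lfun1 (W2 s) (phi2 i).
  have [W1 V1] := (Lfun21 (W2 s), Lfun21 (phi2 i)).
  rewrite Wcons covarianceE// fineB ?fineM ?fin_numM ?expectation_fin_num//.
  by rewrite addrC subrK.
have {C0}C0 : 0 <= fine (covariance P (W s) (fun w => phi (Z i w))).
  exact: fine_ge0.
have {C1}C1 : fine (covariance P (W s) (fun w => phi (Z i w))) <=
    c ^+ 2 * \sum_(j <- s) fine (covariance P (Z i) (Z j)).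
  rewrite -lee_fin fineK// (le_trans C1)// (EFinM (c ^+ 2)) -sumEFin.
  rewrite lee_wpmul2l//.
    by rewrite lee_fin sqr_ge0.
  by apply: lee_sum => j _; rewrite fineK ?fin_num_covariance// covarianceC.
have E0 : 0 <= fine 'E_P[fun w => phi (Z i w)].
  by rewrite fine_ge0// expectation_ge0.
have E1 : fine 'E_P[fun w => phi (Z i w)] <= 1.
  rewrite -lee_fin fineK ?expectation_fin_num ?Lfun21// -(expectation_cst P 1).
  apply: expectation_le => //.
  - exact: measurableT_comp.
  - by apply/aeW => w.
have D1 : \sum_(j <- s) fine (covariance P (Z i) (Z j)) +
    \sum_(a <- s) \sum_(b <- s | a != b) fine (covariance P (Z a) (Z b)) <=
    \sum_(a <- i :: s) \sum_(b <- i :: s | a != b)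
      fine (covariance P (Z a) (Z b)).
  rewrite big_cons lerD//.
    rewrite big_cons eqxx/= [leRHS]big_mkcond.
    rewrite big_seq [leRHS]big_seq ler_sum// => j js.
    by case: ifPn => //; rewrite negbK => /eqP ij; rewrite ij js in iNs.
  rewrite ler_sum// => a _; rewrite [leRHS]big_cons; case: ifP => // _.
  by rewrite lerDr fine_ge0// covariance_ge0.
rewrite -EW.
set e := fine 'E_P[fun w => phi (Z i w)] in E0 E1 *.
set C := fine (covariance P (W s) _) in C0 C1 *.
set S2 := \sum_(a <- i :: s) _ in D1 *.
have -> : fine 'E_P[W s] * e + C -
    e * \prod_(j <- s) fine 'E_P[fun w => phi (Z j w)] =
    e * (fine 'E_P[W s] - \prod_(j <- s) fine 'E_P[fun w => phi (Z j w)]) + C.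
  by ring.
rewrite (le_trans (ler_normD _ _))// normrM (ger0_norm E0) (ger0_norm C0).
apply: (le_trans (lerD (ler_piMl (normr_ge0 _) E1) C1)).
apply: (le_trans (lerD (ih us) (lexx _))).
by rewrite -mulrDr ler_wpM2l ?sqr_ge0// addrC.
Qed.

End newman.

(** * Laplace kernel and natural numbers *)

Section laplace.
Context (R : realType).
Implicit Types t x y : R.

(** The kernel of the Laplace transform on the half-line, extended by its value at
    0 to the negatives: this makes it monotone, bounded by 1 and Lipschitz on the
    whole line, as association only knows about functions on all of R^n. *)
Definition laplace (t x : R) := expR (- (t * Num.max x 0)).

Lemma laplace_nat t k : laplace t k%:R = expR (- t) ^+ k.
Proof. by rewrite /laplace max_l// -mulNr expRM_natr. Qed.

Lemma laplace_noninc t x y : 0 <= t -> x <= y -> laplace t y <= laplace t x.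
Proof.
move=> t0 xy; rewrite ler_expR lerN2 ler_wpM2l//.
by rewrite ge_max !le_max xy lexx orbT.
Qed.

Lemma laplace_ge0 t x : 0 <= laplace t x. Proof. exact: expR_ge0. Qed.

Lemma laplace_le1 t x : 0 <= t -> laplace t x <= 1.
Proof. by move=> t0; rewrite expR_le1 oppr_le0 mulr_ge0// le_max lexx orbT. Qed.

Lemma laplace_lip t x y : 0 <= t -> x <= y -> laplace t x - laplace t y <= t * (y - x).
Proof.
move=> t0 xy; set a := t * Num.max x 0; set b := t * Num.max y 0.
have a0 : 0 <= a by rewrite mulr_ge0// le_max lexx orbT.
have ab : b - a <= t * (y - x).
  rewrite -mulrBr ler_wpM2l//.
  by case: (leP x 0) => x0; case: (leP y 0) => y0; lra.
rewrite /laplace -/a -/b; apply: le_trans ab.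
have -> : - b = - a + - (b - a) by ring.
have := expR_ge1Dx (- (b - a)).
have := expR_ge0 (- a).
have : expR (- a) <= 1 by rewrite expR_le1; lra.
rewrite expRD.
have : 0 <= b - a.
  rewrite subr_ge0 ler_wpM2l//.
  by rewrite ge_max !le_max xy lexx orbT.
move=> ba0.
have : expR (- (b - a)) <= 1.
  by rewrite expR_le1 oppr_le0.
nra.
Qed.

Lemma measurable_laplace t : 0 <= t -> measurable_fun [set: R] (laplace t).
Proof.
by move=> t0; apply: nonincreasing_measurable => // x y; exact: laplace_noninc.
Qed.

Definition natset : set R := range (fun k : nat => k%:R).

Lemma measurable_natset : measurable natset.
Proof.
apply: countable_measurable; first exact: measurable_set1.
exact: (card_le_trans (card_image_le _ _) (countableP _)).
Qed.

End laplace.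
Arguments natset : clear implicits.

(** * Shifted geometric laws *)

Lemma integral_nat (R : realType) (mu : {measure set nat -> \bar R})
    (f : nat -> \bar R) : (forall k, 0 <= f k)%E ->
  (\int[mu]_k f k = \sum_(k <oo) f k * mu [set k])%E.
Proof.
move=> f0.
have -> : [set: nat] = \bigcup_k [set k].
  by apply/seteqP; split => // k _; exists k.
rewrite ge0_integral_bigcup//; last first.
  by move=> i j _ _ [x [/= -> ->]].
apply: eq_eseriesr => k _.
rewrite (eq_integral (cst (f k))) => [|x /set_mem ->//].
by rewrite integral_cst.
Qed.

(** Since rho <= 1, k rho^k <= 1 + rho + ... + rho^(k - 1), and 1 - rho
    times that sum is 1 - rho^k. *)
Lemma natr_geometric_bound (R : realType) (rho : R) k : 0 <= rho <= 1 ->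
  k%:R * rho ^+ k * (1 - rho) <= 1.
Proof.
move=> /andP[r0 r1]; apply: (@le_trans _ _ (1 - rho ^+ k)); last first.
  by rewrite gerBl exprn_ge0.
elim: k => [|k ih]; first by rewrite !mul0r expr0 subrr.
have a1 : 0 <= (1 - rho) * (1 - rho * rho ^+ k).
  by rewrite mulr_ge0// subr_ge0// -exprS exprn_ile1.
have := ler_wpM2l r0 ih.
by rewrite -natr1 exprS; lra.
Qed.

Section shifted_geometric.
Context (R : realType) (p : R) d (T : measurableType d) (P : probability T R).
Context (X : {RV P >-> R}).
Hypothesis p01 : 0 < p < 1.
Hypothesis X_law : same_law (P := P) (Q := geometric_prob p) X
  ((natr_rv R : {mfun nat >-> R}) - 1).

Lemma geometric_prob_set1 k :
  geometric_prob p [set k] = (geometric_pmf p k)%:E.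
Proof.
case/andP: p01 => p0 p1.
rewrite /geometric_prob p0 (ltW p1)/= esum_set1//.
by rewrite lee_fin geometric_pmf_ge0// p0 ltW.
Qed.

Lemma integral_shifted_geometric (F : R -> \bar R) :
  measurable_fun [set: R] F -> (forall x, 0 <= F x)%E ->
  (\int[P]_w F (X w) = \sum_(k <oo) F k%:R * (p * (1 - p) ^+ k)%:E)%E.
Proof.
move=> mF F0.
rewrite -(@ge0_integral_distribution _ _ _ _ _ P X)//.
rewrite (eq_measure_integral (distribution (geometric_prob p)
  ((natr_rv R : {mfun nat >-> R}) - 1))); last first.
  by move=> A mA _; exact: X_law.
rewrite ge0_integral_distribution// integral_nat//; last by move=> k; exact: F0.
have [p0 p1] := andP p01.
have pmf0 k : 0 <= geometric_pmf p k by rewrite geometric_pmf_ge0// p0 ltW.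
rewrite (eq_eseriesr (g := fun k =>
    (F (k%:R - 1)%R * (geometric_pmf p k)%:E)%E)); last first.
  by move=> k _; congr (_ * _)%E; exact: geometric_prob_set1.
have F1 k : (0 <= F (k%:R - 1)%R * (geometric_pmf p k)%:E)%E.
  by rewrite mule_ge0// lee_fin.
(* the geometric law does not charge 0, so that F (- 1) drops out *)
rewrite nneseries_recl// mule0 add0e -nneseries_addn//.
apply: eq_eseriesr => k _.
by rewrite addn1 /geometric_pmf/= subn1/= -natr1 addrK.
Qed.

Lemma integral_laplace_shifted_geometric t : 0 <= t ->
  (\int[P]_w (laplace t (X w))%:E = (p / (1 - (1 - p) * expR (- t)))%:E)%E.
Proof.
move=> t0; case/andP: p01 => p0 p1.
rewrite (integral_shifted_geometric (F := EFin \o laplace t)) /=; last 2 first.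
  by apply/measurable_EFinP; exact: measurable_laplace.
  by move=> x; rewrite lee_fin laplace_ge0.
apply/cvg_lim => //.
rewrite (_ : (fun _ => _) =
    EFin \o series (geometric p ((1 - p) * expR (- t)))); last first.
  apply/funext => n /=; rewrite -sumEFin; apply: eq_bigr => k _.
  by rewrite /= laplace_nat -EFinM exprMn mulrCA [X in p * X]mulrC.
apply: cvg_EFin; first exact: nearW.
apply: cvg_geometric_series.
have : expR (- t) <= 1 by rewrite expR_le1 oppr_le0.
have := expR_gt0 (- t) => e0 e1.
rewrite ger0_norm ?mulr_ge0 ?subr_ge0 ?ltW//.
nra.
Qed.

Lemma integral_sqr_shifted_geometric : (\int[P]_w (X w ^+ 2)%:E < +oo)%E.
Proof.
case/andP: p01 => p0 p1.
rewrite (integral_shifted_geometric (F := fun x => (x ^+ 2)%:E)); last 2 first.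
  by apply/measurable_EFinP; exact: measurable_funX.
  by move=> x; rewrite lee_fin sqr_ge0.
(* with four powers of rho at hand, two absorb the factor k ^ 2 and the other two
   leave a convergent geometric series *)
pose rho := Num.sqrt (Num.sqrt (1 - p)).
have rho0 : 0 <= rho by exact: sqrtr_ge0.
have rho4 : rho ^+ 2 ^+ 2 = 1 - p by rewrite !sqr_sqrtr ?sqrtr_ge0// subr_ge0 ltW.
have rho1 : rho < 1.
  by rewrite -(@expr_lt1 _ 4)// (exprM _ 2 2) rho4; lra.
pose C := (1 - rho)^-1.
apply: (@le_lt_trans _ _ (\sum_(k <oo) (geometric (p * C ^+ 2) (rho ^+ 2) k)%:E)%E).
  apply: lee_nneseries => k _; first rewrite mule_ge0// lee_fin ?sqr_ge0//.
    by rewrite mulr_ge0 ?exprn_ge0// ?subr_ge0 ltW.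
  rewrite -EFinM lee_fin /= -rho4 [leLHS]mulrCA -[leRHS]mulrA ler_wpM2l ?(ltW p0)//.
  have -> : k%:R ^+ 2 * rho ^+ 2 ^+ 2 ^+ k =
      (k%:R * rho ^+ k) ^+ 2 * rho ^+ 2 ^+ k :> R.
    by rewrite [in RHS]exprMn -!exprM -[RHS]mulrA -exprD (mulnC k) addnn -mul2n mulnA.
  rewrite ler_wpM2r ?exprn_ge0//.
  apply: lerXn2r; first by rewrite nnegrE mulr_ge0// exprn_ge0.
    by rewrite nnegrE invr_ge0 subr_ge0 ltW.
  rewrite /C -[leRHS]mul1r ler_pdivlMr ?subr_gt0//.
  by apply: natr_geometric_bound; rewrite rho0 ltW.
rewrite (_ : \sum_(k <oo) _ = (p * C ^+ 2 / (1 - rho ^+ 2))%:E)%E ?ltry//.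
apply/cvg_lim => //.
under eq_fun do rewrite sumEFin.
apply: cvg_EFin; first exact: nearW.
apply: cvg_geometric_series.
by rewrite ger0_norm ?sqr_ge0// expr_lt1.
Qed.

Lemma shifted_geometric_nat : P (X @^-1` (~` natset R)) = 0%E.
Proof.
have mN : measurable (~` natset R) by apply: measurableC; exact: measurable_natset.
transitivity (\int[P]_w (\1_(~` natset R) (X w))%:E)%E.
  rewrite -[X in P X]setIT -integral_indic//.
  by rewrite -[X in measurable X]setTI; exact: measurable_funPT.
rewrite (integral_shifted_geometric
  (F := fun x => (\1_(~` natset R) x)%:E)); last 2 first.
  by apply/measurable_EFinP; exact: measurable_indic.
  by move=> x; rewrite lee_fin.
rewrite eseries0// => k _ _; rewrite indicE memNset ?mul0e//=.
by apply; exists k.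
Qed.
End shifted_geometric.

(** * Laws carried by the natural numbers *)

Section nat_supported.
Context (R : realType).

Definition nattail K : set R := [set k%:R | k in [set k : nat | (K <= k)%N]].

Lemma measurable_nattail K : measurable (nattail K).
Proof.
apply: countable_measurable; first exact: measurable_set1.
exact: (card_le_trans (card_image_le _ _) (countableP _)).
Qed.

Lemma nattail_recl K : nattail K = [set K%:R] `|` nattail K.+1.
Proof.
apply/seteqP; split => [_ [k /= Kk <-]|x].
  by move: Kk; rewrite leq_eqVlt => /predU1P[->|Kk]; [left|right; exists k].
case=> [->|[k /= Kk <-]]; first by exists K => //=.
by exists k => //=; exact: ltnW.
Qed.

Definition mass (mu : probability R R) (k : nat) := fine (mu [set k%:R]).

Variable mu : probability R R.
Hypothesis mu_nat : mu (~` natset R) = 0%E.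

Lemma integrable_bounded (f : R -> R) B : measurable_fun [set: R] f ->
  (forall x, `|f x| <= B) -> mu.-integrable [set: R] (EFin \o f).
Proof.
move=> mf fB; apply: measurable_bounded_integrable => //.
  by rewrite -ge0_fin_numE// fin_num_measure.
by exists B; split; [exact: num_real|move=> b Bb x _; exact: le_trans (ltW Bb)].
Qed.

(** The induction on K peels the atoms 0, 1, ... off the support one by one. *)
Lemma Rintegral_nattail (f : R -> R) B K : measurable_fun [set: R] f ->
  (forall x, `|f x| <= B) ->
  \int[mu]_x f x =
  \sum_(0 <= j < K) f j%:R * mass mu j + \int[mu]_(x in nattail K) f x.
Proof.
move=> mf fB; have fi := integrable_bounded mf fB.
elim: K => [|K ->].
  rewrite big_geq// add0r /Rintegral.
  rewrite (negligible_integral _ _ fi mu_nat)//; last first.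
    by apply: measurableC; exact: measurable_natset.
  rewrite setTD setCK; congr (fine (integral _ _ _)).
  by apply/seteqP; split => [_ [k _ <-]|_ [k _ <-]]; exists k.
rewrite big_nat_recr//= -addrA; congr (_ + _).
rewrite nattail_recl Rintegral_setU//.
- congr (_ + _).
  rewrite (@eq_Rintegral _ _ _ _ _ (cst (f K%:R))) => [|x /set_mem/= -> //].
  by rewrite Rintegral_cst.
- exact: measurable_nattail.
- by apply: integrableS fi => //; apply: measurableU => //; exact: measurable_nattail.
- apply/disj_set2P; apply/seteqP; split => // x [/= -> [k /= Kk /eqP]].
  by rewrite eqr_nat => /eqP kK; rewrite kK ltnn in Kk.
Qed.

Lemma mass_ge0 j : 0 <= mass mu j. Proof. exact: fine_ge0. Qed.

Lemma sum_mass K :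
  \sum_(0 <= j < K) mass mu j + fine (mu (nattail K)) = 1.
Proof.
have := @Rintegral_nattail (cst 1) 1 K (measurable_cst _).
rewrite (Rintegral_cst mu measurableT) (Rintegral_cst mu (measurable_nattail K)).
rewrite !mul1r (_ : fine (mu [set: R]) = 1) ?probability_setT// => -> //; last first.
  by move=> x; rewrite normr1.
by congr (_ + _); apply: eq_bigr => j _; rewrite mul1r.
Qed.

(** Both sides are integrals over the tail K, K + 1, ... of the support, of
    f and of the constant M. *)
Lemma Rintegral_trunc (f : R -> R) B K M : measurable_fun [set: R] f ->
  (forall x, `|f x| <= B) -> (forall k, (K <= k)%N -> `|f k%:R| <= M) ->
  `|\int[mu]_x f x - \sum_(0 <= j < K) f j%:R * mass mu j| <=
  M * (1 - \sum_(0 <= j < K) mass mu j).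
Proof.
move=> mf fB fM; have fi := integrable_bounded mf fB.
have mK := measurable_nattail K.
have fiK : mu.-integrable (nattail K) (EFin \o f) by exact: integrableS fi.
rewrite (Rintegral_nattail K mf fB) addrAC subrr add0r.
rewrite -(sum_mass K) addrAC subrr add0r.
rewrite -(@Rintegral_cst _ _ _ mu)//.
apply: (le_trans (le_normr_Rintegral _ _)) => //.
apply: le_Rintegral => //.
- exact: integrable_norm.
- by apply: (@integrableS _ _ _ _ setT) => //; exact: finite_measure_integrable_cst.
- by move=> _ [k /= Kk <-]; exact: fM.
Qed.

End nat_supported.
Arguments nattail : clear implicits.

(** * Continuity theorem for Laplace transforms *)

Lemma cvg_sum_nat (R : realType) K (u : nat -> nat -> R) (l : nat -> R) :
  (forall j, (j < K)%N -> u j n @[n --> \oo] --> l j) ->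
  \sum_(0 <= j < K) u j n @[n --> \oo] --> \sum_(0 <= j < K) l j.
Proof.
elim: K => [_|K ih ul].
  by rewrite big_geq//; under eq_cvg do rewrite big_geq//; exact: cvg_cst.
rewrite big_nat_recr//=; under eq_cvg do rewrite big_nat_recr//=.
by apply: cvgD; [apply: ih => j jK; exact/ul/ltnW|exact: ul].
Qed.

Section continuity.
Context (R : realType).

(** The Laplace transform at t is the generating function at exp (- t); removing
    its first terms leaves the next one up to the tail of a power series. *)
Lemma laplace_trunc (mu : probability R R) t k : mu (~` natset R) = 0%E -> 0 <= t ->
  `|\int[mu]_x laplace t x - \sum_(0 <= j < k) expR (- t) ^+ j * mass mu j -
    expR (- t) ^+ k * mass mu k| <= expR (- t) ^+ k.+1.
Proof.
move=> muN t0.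
have s0 := expR_ge0 (- t).
have s1 : expR (- t) <= 1 by rewrite expR_le1 oppr_le0.
have := @Rintegral_trunc _ mu muN (laplace t) 1 k.+1 (expR (- t) ^+ k.+1)
  (measurable_laplace t0).
rewrite big_nat_recr//= opprD addrA.
under eq_bigr do rewrite laplace_nat.
rewrite laplace_nat => H; apply: (le_trans (H _ _)).
- by move=> x; rewrite ger0_norm ?laplace_ge0 ?laplace_le1.
- by move=> j kj; rewrite laplace_nat ger0_norm ?exprn_ge0// ler_wiXn2l.
- rewrite ler_piMr ?exprn_ge0// gerBl sumr_ge0// => j _; exact: mass_ge0.
Qed.

Context (mu : nat -> probability R R) (nu : probability R R).
Hypothesis mu_nat : \forall n \near \oo, mu n (~` natset R) = 0%E.
Hypothesis nu_nat : nu (~` natset R) = 0%E.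

(** Continuity theorem, at the level of masses, by strong induction on k: once
    the masses of 0, ..., k - 1 converge, so does the remainder of the generating
    function at s, which is s^k times the mass of k up to s^(k + 1). Dividing by
    s^k leaves an error of order s, and s is arbitrary. *)
Lemma cvg_mass :
  (forall t, 0 < t ->
    (\int[mu n]_x laplace t x) @[n --> \oo] --> (\int[nu]_x laplace t x)) ->
  forall k, mass (mu n) k @[n --> \oo] --> mass nu k.
Proof.
move=> cvg_laplace; elim/ltn_ind => k IH.
apply/cvgrPdist_le => e e0.
(* the three s in the error: one from truncating each transform, one from
   D (mu n) --> D nu *)
pose s := Num.min 2^-1 (e / 3).
have s0 : 0 < s by rewrite lt_min invr_gt0 divr_gt0 ?ltr0n.
have s1 : s < 1 by rewrite gt_min invf_lt1 ?ltr1n.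
have se : 3 * s <= e by rewrite mulrC -ler_pdivlMr ?ltr0n// ge_min lexx orbT.
pose t := - ln s.
have sE : expR (- t) = s by rewrite opprK lnK.
have t0 : 0 < t by rewrite oppr_gt0 ln_lt0// s0.
pose D (m : probability R R) :=
  \int[m]_x laplace t x - \sum_(0 <= j < k) s ^+ j * mass m j.
have cvgD : D (mu n) @[n --> \oo] --> D nu.
  apply: cvgB; first exact: cvg_laplace.
  by apply: cvg_sum_nat => j jk; apply: cvgMl_tmp; exact: IH.
have sk0 : 0 < s ^+ k by rewrite exprn_gt0.
have Dnear : \forall n \near \oo, `|D nu - D (mu n)| <= s ^+ k.+1.
  by move/cvgrPdist_le : cvgD; apply; rewrite exprn_gt0.
near=> n.
have Dn : `|D nu - D (mu n)| <= s ^+ k.+1 by near: n.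
have mun : mu n (~` natset R) = 0%E by near: n.
have := laplace_trunc k mun (ltW t0); have := laplace_trunc k nu_nat (ltW t0).
rewrite sE -/(D nu) -/(D (mu n)) => H1 H2.
suff : s ^+ k * `|mass nu k - mass (mu n) k| <= s ^+ k * (3 * s).
  by rewrite ler_pM2l// => /le_trans; apply.
rewrite -{1}(ger0_norm (ltW sk0)) -normrM.
move: Dn H1 H2; rewrite exprS !ler_norml => /andP[? ?] /andP[? ?] /andP[? ?].
by apply/andP; split; lra.
Unshelve. all: by end_near. Qed.

Lemma cvg_sum_mass (m : probability R R) : m (~` natset R) = 0%E ->
  \sum_(0 <= j < K) mass m j @[K --> \oo] --> (1 : R).
Proof.
move=> mN.
rewrite (_ : (fun _ => _) = fun K => 1 - fine (m (nattail R K))); last first.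
  by apply/funext => K; rewrite -(sum_mass mN K) addrK.
rewrite -[X in _ --> X]subr0; apply: cvgB; first exact: cvg_cst.
apply: fine_cvg.
have -> : 0%:E = m (\bigcap_K nattail R K).
  rewrite (_ : \bigcap_K _ = set0) ?measure0// -subset0 => x xK.
  have [k _ kx] := xK 0%N I; have [j /= kj jx] := xK k.+1 I.
  move: jx; rewrite -kx => /eqP; rewrite eqr_nat => /eqP jk.
  by rewrite jk ltnn in kj.
apply: nonincreasing_cvg_mu => //.
- by rewrite -ge0_fin_numE// fin_num_measure//; exact: measurable_nattail.
- by move=> K; exact: measurable_nattail.
- by apply: bigcapT_measurable => K; exact: measurable_nattail.
- move=> a b ab; apply/subsetPset => _ [k /= bk <-]; exists k => //=.
  exact: leq_trans bk.
Qed.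

(** Scheffe's argument: as the limit has total mass 1, no mass can escape to
    infinity. *)
Lemma cvg_mass_weakly :
  (forall k, mass (mu n) k @[n --> \oo] --> mass nu k) ->
  weakly_converges mu nu.
Proof.
move=> cvgm f cf [M [_ fM]].
pose B := M + 1.
have {}fM x : `|f x| <= B by apply: fM => //; rewrite ltrDl.
have mf : measurable_fun [set: R] f by exact: continuous_measurable_fun.
apply/cvgrPdist_le => e e0.
pose r (m : probability R R) K := B * (1 - \sum_(0 <= j < K) mass m j).
have [K nuK] : exists K, r nu K <= e / 4.
  have : r nu K @[K --> \oo] --> (0 : R).
    rewrite -(mulr0 B) -[X in _ * X](subrr 1); apply: cvgMl_tmp; apply: cvgB.
      exact: cvg_cst.
    exact: cvg_sum_mass.
  move/cvgrPdist_le => /(_ (e / 4)) [|K _ /(_ K (leqnn K))]; first by rewrite divr_gt0.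
  by rewrite sub0r normrN => /ler_normlW ?; exists K.
pose a (m : probability R R) := \sum_(0 <= j < K) f j%:R * mass m j.
have cvga : a (mu n) @[n --> \oo] --> a nu.
  by apply: cvg_sum_nat => j _; apply: cvgMl_tmp; exact: cvgm.
have cvgr : r (mu n) K @[n --> \oo] --> r nu K.
  apply: cvgMl_tmp; apply: cvgB; first exact: cvg_cst.
  by apply: cvg_sum_nat => j _; exact: cvgm.
(* a quarter of e for each of: the finite sums a, the tail of nu, and the tail of
   mu n, which is the tail of nu up to another quarter *)
have e4 : 0 < e / 4 by rewrite divr_gt0.
near=> n.
have an : `|a nu - a (mu n)| <= e / 4.
  by near: n; move/cvgrPdist_le : cvga; exact.
have rn : `|r nu K - r (mu n) K| <= e / 4.
  by near: n; move/cvgrPdist_le : cvgr; exact.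
have mun : mu n (~` natset R) = 0%E by near: n.
have := @Rintegral_trunc _ _ mun f B K B mf fM (fun k _ => fM _).
have := @Rintegral_trunc _ _ nu_nat f B K B mf fM (fun k _ => fM _).
rewrite -/(a nu) -/(a (mu n)) -/(r nu K) -/(r (mu n) K).
move: an rn nuK; rewrite !ler_norml.
move=> /andP[? ?] /andP[? ?] ? /andP[? ?] /andP[? ?].
by apply/andP; split; lra.
Unshelve. all: by end_near. Qed.

End continuity.

(** * Poisson law and products of geometric transforms *)

Lemma poisson_law_nat (R : realType) (lambda : R) :
  poisson_law lambda (~` natset R) = 0%E.
Proof.
rewrite /poisson_law /distribution /= /pushforward (_ : _ @^-1` _ = set0) ?measure0//.
by rewrite -subset0 => k; apply; exists k.
Qed.

Lemma poisson_laplace (R : realType) (lambda t : R) : 0 < lambda -> 0 <= t ->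
  \int[poisson_law lambda]_x laplace t x = expR (- ((1 - expR (- t)) * lambda)).
Proof.
move=> l0 t0; rewrite /Rintegral ge0_integral_distribution//; last 2 first.
- by apply/measurable_EFinP; exact: measurable_laplace.
- by move=> x; rewrite lee_fin laplace_ge0.
rewrite integral_nat; last by move=> k; rewrite lee_fin laplace_ge0.
rewrite (eq_eseriesr (g := fun k =>
    (expR (- lambda) * exp_coeff (lambda * expR (- t)) k)%:E)); last first.
  move=> k _.
  rewrite (_ : _ [set k] = (poisson_pmf lambda k)%:E); last first.
    by rewrite /= /poisson_prob l0 esum_set1// lee_fin poisson_pmf_ge0.
  rewrite /= laplace_nat -EFinM /poisson_pmf l0 /exp_coeff /= exprMn; congr EFin.
  by ring.
rewrite (_ : \sum_(k <oo) _ = (expR (- ((1 - expR (- t)) * lambda)))%:E)%E//.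
apply/cvg_lim => //; under eq_fun do rewrite sumEFin -mulr_sumr.
apply: cvg_EFin; first exact: nearW.
rewrite (_ : - ((1 - _) * _) = - lambda + lambda * expR (- t)); last by ring.
rewrite expRD; apply: cvgMl_tmp.
exact: is_cvg_series_exp_coeff.
Qed.

(** The middle term is the Laplace transform of a shifted geometric law, with
    s = exp (- t). Upper bound: it is at most 1 - (1 - s) q, and 1 + x <= exp x.
    Lower bound: its inverse is 1 + (1 - s) q / p with p >= 1 - b. Having
    exponentials on both sides makes products over a row explicit. *)
Lemma geometric_laplace_bounds (R : realType) (p b s : R) :
  0 < p < 1 -> 1 - p <= b -> b < 1 -> 0 <= s <= 1 ->
  expR (- ((1 - s) * (1 - p) / (1 - b))) <= p / (1 - (1 - p) * s)
    <= expR (- ((1 - s) * (1 - p))).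
Proof.
move=> /andP[p0 p1] pb b1 /andP[s0 s1].
have d0 : 0 < 1 - (1 - p) * s by nra.
apply/andP; split.
  rewrite expRN -[leRHS]invf_div lef_pV2 ?posrE ?expR_gt0 ?divr_gt0//.
  apply: le_trans (expR_ge1Dx _); rewrite ler_pdivrMr//.
  set u := _ / _.
  have : (1 - s) * (1 - p) <= u * p.
    rewrite /u mulrAC ler_pdivlMr ?subr_gt0//.
    by rewrite ler_wpM2l ?mulr_ge0 ?subr_ge0//; lra.
  lra.
apply: le_trans (expR_ge1Dx _); rewrite ler_pdivrMr//.
have : 0 <= (1 - p) ^+ 2 * (s * (1 - s)).
  by rewrite (mulr_ge0 (sqr_ge0 _))// mulr_ge0// subr_ge0.
lra.
Qed.

(** Product of [geometric_laplace_bounds] over the row: both bounds depend on the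
    row only through b n and the sum of the 1 - p, which converge. *)
Lemma cvg_prod_geometric_laplace (R : realType) (N : nat -> nat)
    (p : forall n, 'I_(N n) -> R) (b : nat -> R) (lambda s : R) :
  0 <= s <= 1 ->
  (\forall n \near \oo, forall i, 0 < p n i < 1 /\ 1 - p n i <= b n) ->
  b n @[n --> \oo] --> (0 : R) ->
  \sum_(i < N n) (1 - p n i) @[n --> \oo] --> lambda ->
  \prod_(i < N n) (p n i / (1 - (1 - p n i) * s)) @[n --> \oo] -->
    expR (- ((1 - s) * lambda)).
Proof.
move=> s01 pb cvgb cvgQ; pose Q n := \sum_(i < N n) (1 - p n i).
have expQ n a : expR (- ((1 - s) * Q n * a)) =
    \prod_(i < N n) expR (- ((1 - s) * (1 - p n i) * a)).
  by rewrite -expR_sum /Q mulr_sumr mulr_suml -sumrN.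
have b_lt1 : \forall n \near \oo, b n < 1 by exact: (cvgr_lt _ cvgb).
apply: (@squeeze_cvgr _ _ _ _ (fun n => expR (- ((1 - s) * Q n * (1 - b n)^-1)))
  (fun n => expR (- ((1 - s) * Q n * 1)))).
- near=> n.
  have b1 : b n < 1 by near: n.
  have pbn : forall i, 0 < p n i < 1 /\ 1 - p n i <= b n by near: n.
  have bounds i := geometric_laplace_bounds (pbn i).1 (pbn i).2 b1 s01.
  rewrite !expQ; apply/andP; split; apply: ler_prod => i _.
    by rewrite expR_ge0; case/andP: (bounds i).
  rewrite mulr1; have /andP[lo ->] := bounds i.
  by rewrite (le_trans _ lo)// expR_ge0.
- apply: continuous_cvg; first exact: continuous_expR.
  apply: cvgN; rewrite -[X in _ --> X]mulr1; apply: cvgM.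
    exact: cvgMl_tmp.
  have : (1 - b n)^-1 @[n --> \oo] --> (1 - 0 : R)^-1.
    apply: cvgV; first by rewrite subr0 oner_neq0.
    by apply: cvgB => //; exact: cvg_cst.
  by rewrite subr0 invr1.
- apply: continuous_cvg; first exact: continuous_expR.
  apply: cvgN; under eq_cvg do rewrite mulr1.
  exact: cvgMl_tmp.
Unshelve. all: by end_near. Qed.

(** * Sums over an associated row *)

Section row.
Context d (T : measurableType d) (R : realType) (P : probability T R).
Context (n : nat) (Z : 'I_n -> {RV P >-> R}) (p : 'I_n -> R) (S : {RV P >-> R}).
Hypothesis Z_assoc : associated Z.
Hypothesis p01 : forall i, 0 < p i < 1.
Hypothesis Z_law : forall i, same_law (P := P) (Q := geometric_prob (p i))
  (Z i) ((natr_rv R : {mfun nat >-> R}) - 1).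
Hypothesis SE : forall w, S w = \sum_i Z i w.

Lemma ae_row_nat : \forall w \ae P, forall i, natset R (Z i w).
Proof.
apply: filter_forall => i; exists (Z i @^-1` (~` natset R)); split => //.
- rewrite -[X in measurable X]setTI; apply: measurable_funPT => //.
  by apply: measurableC; exact: measurable_natset.
- exact: shifted_geometric_nat.
Qed.

Lemma natset_sum (f : 'I_n -> R) :
  (forall i, natset R (f i)) -> natset R (\sum_i f i).
Proof.
move=> fN; apply: (big_ind (natset R)) => //; first by exists 0%N.
by move=> _ _ [a _ <-] [b _ <-]; exists (a + b)%N => //; rewrite natrD.
Qed.

Lemma row_sum_nat : distribution P S (~` natset R) = 0%E.
Proof.
rewrite -[LHS]/(P (S @^-1` (~` natset R))).
apply: measure_negligible.
  rewrite -[X in measurable X]setTI; apply: measurable_funPT => //.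
  by apply: measurableC; exact: measurable_natset.
have : \forall w \ae P, natset R (S w).
  by apply: filterS ae_row_nat => w Zw; rewrite SE; exact: natset_sum.
by [].
Qed.

Lemma laplace_nat_sum t (f : 'I_n -> R) : (forall i, natset R (f i)) ->
  laplace t (\sum_i f i) = \prod_i laplace t (f i).
Proof.
move=> fN.
suff [_ //] : natset R (\sum_i f i) /\
    laplace t (\sum_i f i) = \prod_i laplace t (f i).
apply: (big_ind2 (fun x y => natset R x /\ laplace t x = y)) => //.
- by split; [exists 0%N|rewrite (laplace_nat t 0)].
- move=> x1 y1 x2 y2 [[a _ <-] <-] [[b _ <-] <-]; split.
    by exists (a + b)%N => //; rewrite natrD.
  by rewrite -natrD !laplace_nat exprD.
Qed.

(** Almost surely the variables are natural numbers, and there the kernel turns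
    sums into products; so this is [expectation_prod_le] for the kernel, whose
    Lipschitz constant is t. *)
Lemma row_sum_laplace t : 0 <= t ->
  `|\int[distribution P S]_x laplace t x -
    \prod_i (p i / (1 - (1 - p i) * expR (- t)))| <=
  t ^+ 2 * \sum_i \sum_(j | i != j) fine (covariance P (Z i) (Z j)).
Proof.
move=> t0.
have Z2 i : (Z i : T -> R) \in Lfun P 2%:E.
  by apply: Lfun2_sqr => //; exact: (integral_sqr_shifted_geometric (p01 i) (Z_law i)).
have mlZ i : measurable_fun [set: T] (fun w => laplace t (Z i w)).
  by apply: measurableT_comp => //; exact: measurable_laplace.
have -> : \int[distribution P S]_x laplace t x =
    fine 'E_P[fun w => \prod_i laplace t (Z i w)].
  rewrite /Rintegral ge0_integral_distribution//; last 2 first.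
  - by apply/measurable_EFinP; exact: measurable_laplace.
  - by move=> x; rewrite lee_fin laplace_ge0.
  rewrite unlock; congr fine; apply: ae_eq_integral => //.
  - apply/measurable_EFinP; apply: measurableT_comp => //; exact: measurable_laplace.
  - by apply/measurable_EFinP; apply: measurable_prod => i _.
  - by apply: filterS ae_row_nat => w Zw _; rewrite /= SE laplace_nat_sum.
have -> : \prod_i (p i / (1 - (1 - p i) * expR (- t))) =
    \prod_i fine 'E_P[fun w => laplace t (Z i w)].
  apply: eq_bigr => i _.
  by rewrite unlock (integral_laplace_shifted_geometric (p01 i) (Z_law i)).
apply: expectation_prod_le => // [x|x|x y|x y|].
- exact: laplace_ge0.
- exact: laplace_le1.
- exact: laplace_noninc.
- exact: laplace_lip.
- exact: index_enum_uniq.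
Qed.
End row.

Lemma sum_offdiag_le (R : realFieldType) n (c : 'I_n -> 'I_n -> R) M : 0 <= M ->
  (forall i j, i != j -> n%:R ^+ 2 * c i j <= M) ->
  \sum_i \sum_(j | i != j) c i j <= M.
Proof.
move=> M0 cM; have [n0|n0] := eqVneq n 0%N.
  by rewrite big1// => i _; have := ltn_ord i; rewrite {2}n0.
have n2 : 0 < n%:R ^+ 2 :> R by rewrite exprn_gt0// ltr0n lt0n.
pose c0 := M / n%:R ^+ 2.
apply: (@le_trans _ _ (\sum_(i < n) \sum_(j < n) c0)).
  apply: ler_sum => i _; rewrite [leLHS]big_mkcond/=; apply: ler_sum => j _.
  case: ifPn => [ij|_]; last by rewrite divr_ge0// ltW.
  by rewrite ler_pdivlMr// mulrC cM.
rewrite !sumr_const card_ord -mulrnA -mulr_natr natrM -expr2 /c0.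
by rewrite divfK// gt_eqF.
Qed.

Unset Implicit Arguments.
Set Strict Implicit.
Set Printing Implicit Defensive.

Theorem theorem7 (R : realType) (d : measure_display) (T : measurableType d)
  (P : probability T R)
  (kn m l r : nat -> nat)
  (X : nat -> nat -> {RV P >-> R})
  (p q : nat -> nat -> R) (lambda : R) :
  kn n @[n --> \oo] --> \oo ->
  (forall n, (1 <= n)%N -> associated (fun i : 'I_(kn n) => X i.+1 n)) ->
  (forall n, (1 <= n)%N -> kn n = (m n * l n + r n)%N) ->
  (forall n, (1 <= n)%N -> (1 <= m n)%N) ->
  m n @[n --> \oo] --> \oo ->
  (forall n, (1 <= n)%N -> (r n < l n)%N) ->
  ((l n)%:R / (m n)%:R : R) @[n --> \oo] --> (0 : R) ->
  (* (1) *)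
  (forall n k, (1 <= n)%N -> (1 <= k <= kn n)%N -> 0 < p k n < 1) ->
  (forall n k, (1 <= n)%N -> (1 <= k <= kn n)%N ->
     same_law (P := P) (Q := geometric_prob (p k n))
       (X k n) ((natr_rv R : {mfun nat >-> R}) - 1)) ->
  (* (2) *)
  (forall k n, q k n = 1 - p k n) ->
  let qbar n := sup [set q k n | k in [set k | (1 <= k <= kn n)%N]] in
  qbar n @[n --> \oo] --> (0 : R) ->
  (kn n)%:R * qbar n ^+ 2 @[n --> \oo] --> (0 : R) ->
  (* (3) *)
  \sum_(1 <= k < (kn n).+1) q k n @[n --> \oo] --> lambda ->
  0 < lambda ->
  \sum_(1 <= h < (r n).+1) q (m n * l n + h)%N n @[n --> \oo] --> (0 : R) ->
  (((kn n)%:R ^+ 2)%:E *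
    ereal_sup [set covariance P (X rs.1 n) (X rs.2 n) | rs in
      [set rs : nat * nat | [/\ (1 <= rs.1 <= kn n)%N,
                                (1 <= rs.2 <= kn n)%N & rs.1 != rs.2]]])%E
    @[n --> \oo] --> (0 : \bar R) ->
  (* (4) *)
  (((m n)%:R)%:E *
    ereal_sup [set (\sum_(1 <= a < (l n).+1) \sum_(1 <= b < (l n).+1 | a != b)
         covariance P (X ((j - 1) * l n + a)%N n) (X ((j - 1) * l n + b)%N n))%E
       | j in [set j | (1 <= j <= m n)%N]])%E
    @[n --> \oo] --> (0 : \bar R) ->
  (\sum_(1 <= a < (r n).+1) \sum_(1 <= b < (r n).+1 | a != b)
     covariance P (X (m n * l n + a)%N n) (X (m n * l n + b)%N n))%E
    @[n --> \oo] --> (0 : \bar R) ->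
  weakly_converges
    (fun n => distribution P (\sum_(1 <= k < (kn n).+1) X k n))
    (poisson_law lambda).
Proof.
move=> _ Xassoc _ _ _ _ _ p01 Xlaw qE qbar cvgqbar _ cvgQ l0 _ cvgcov _ _.
pose Y n (i : 'I_(kn n)) := X i.+1 n.
pose py n (i : 'I_(kn n)) := p i.+1 n.
pose S n : {RV P >-> R} := \sum_(1 <= k < (kn n).+1) X k n.
have py01 n : (1 <= n)%N -> forall i, 0 < py n i < 1.
  by move=> n0 i; apply: p01 => //=; exact: ltn_ord.
have SE n w : S n w = \sum_i Y n i w.
  rewrite /S big_add1 big_mkord /=.
  by apply: (big_ind2 (fun (f : {RV P >-> R}) y => f w = y)) => // f x g y /= <- <-.
have n1 : \forall n \near \oo, (1 <= n)%N by exact: nbhs_infty_ge.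
have Ylaw n : (1 <= n)%N -> forall i, same_law (P := P)
    (Q := geometric_prob (py n i)) (Y n i) ((natr_rv R : {mfun nat >-> R}) - 1).
  by move=> n0 i; apply: Xlaw => //=; exact: ltn_ord.
have S_nat : \forall n \near \oo, distribution P (S n) (~` natset R) = 0%E.
  apply: filterS n1 => n n0.
  exact: (row_sum_nat (py01 n n0) (Ylaw n n0)).
apply: cvg_mass_weakly; [exact: S_nat|exact: poisson_law_nat|].
apply: cvg_mass; [exact: S_nat|exact: poisson_law_nat|] => t t0.
rewrite poisson_laplace ?ltW//.
set s := expR (- t).
have s01 : 0 <= s <= 1 by rewrite expR_ge0 expR_le1 oppr_le0 ltW.
pose Pi n := \prod_(i < kn n) (py n i / (1 - (1 - py n i) * s)).
have qbar_ub n i : (1 <= n)%N -> 1 - py n i <= qbar n.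
  move=> n0; rewrite /py -qE; apply: ub_le_sup; last first.
    by exists i.+1 => //=; exact: ltn_ord.
  exists 1 => _ [k /= kn1 <-]; rewrite qE gerBl ltW//.
  by case/andP: (p01 n k n0 kn1).
have cvgPi : Pi n @[n --> \oo] --> expR (- ((1 - s) * lambda)).
  apply: (cvg_prod_geometric_laplace s01 _ cvgqbar).
    by apply: filterS n1 => n n0 i; split; [exact: py01|exact: qbar_ub].
  move: cvgQ; under eq_cvg => n do rewrite big_add1 big_mkord/=.
  by under eq_cvg => n do under eq_bigr do rewrite qE.
suff Hdiff : \int[distribution P (S n)]_x laplace t x - Pi n @[n --> \oo] --> (0 : R).
  rewrite -[X in _ --> X]add0r.
  under eq_cvg => n do rewrite -(subrK (Pi n) (\int[_]_x _)).
  exact: cvgD.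
pose V n := (((kn n)%:R ^+ 2)%:E *
  ereal_sup [set covariance P (X rs.1 n) (X rs.2 n) | rs in
      [set rs : nat * nat | [/\ (1 <= rs.1 <= kn n)%N,
                                (1 <= rs.2 <= kn n)%N & rs.1 != rs.2]]])%E.
have /fine_cvgP[Vfin cvgfV] : V n @[n --> \oo] --> (0 : \bar R) by exact: cvgcov.
have cov_le n : (1 <= n)%N -> V n \is a fin_num ->
    \sum_i \sum_(j | i != j) fine (covariance P (Y n i) (Y n j)) <= `|fine (V n)|.
  move=> n0 Vn; apply: sum_offdiag_le => // i j ij.
  have L2 i' : (Y n i' : T -> R) \in Lfun P 2%:E.
    apply: Lfun2_sqr => //.
    exact: (integral_sqr_shifted_geometric (py01 n n0 i') (Ylaw n n0 i')).
  rewrite (le_trans _ (ler_norm _))// -lee_fin (fineK Vn).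
  rewrite (EFinM (_ ^+ 2)) fineK ?fin_num_covariance// /V.
  apply: lee_wpmul2l; first by rewrite lee_fin sqr_ge0.
  by apply: ereal_sup_ubound; exists (i.+1, j.+1) => //=; split => //=.
apply/cvgrPdist_le => e e0.
have e1 : 0 < e / t ^+ 2 by rewrite divr_gt0// exprn_gt0.
near=> n.
have n0 : (1 <= n)%N by near: n.
have Vn : V n \is a fin_num by near: n.
have Ve : `|fine (V n)| <= e / t ^+ 2.
  rewrite -[fine _]opprK normrN -sub0r.
  by near: n; move/cvgrPdist_le : cvgfV; exact.
rewrite sub0r normrN.
apply: le_trans (row_sum_laplace (Xassoc n n0) (py01 n n0) (Ylaw n n0) (SE n) (ltW t0)) _.
rewrite mulrC -ler_pdivlMr ?exprn_gt0//.
exact: le_trans (cov_le n n0 Vn) Ve.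
Unshelve. all: by end_near. Qed.
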